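(* Let $\pi\colon E\to M$ be a fiber bundle and let $\mathcal{Y}\colon J^1\pi\to J^1J^1\pi$ be an integrable jet field. The necessary and sufficient condition for $\mathcal{Y}$ to be a SOPDE is that its integral sections are holonomic.
   Context: All manifolds and maps are $C^\infty$. $J^1\pi$ is the bundle of 1-jets of local sections of $\pi$, with projections $\pi^1\colon J^1\pi\to E$ and $\bar\pi^1=\pi\circ\pi^1\colon J^1\pi\to M$. For a (local) section $\phi$ of $\pi$, $j^1\phi$ is its canonical lifting, the section of $\bar\pi^1$ sending $x$ to the 1-jet of $\phi$ at $x$. $J^1J^1\pi$ is the bundle of 1-jets of local sections of $\bar\pi^1$, with projections $\pi^1_1\colon J^1J^1\pi\to J^1\pi$ and $\bar\pi^1_1=\bar\pi^1\circ\pi^1_1\colon J^1J^1\pi\to M$. For a section $\psi$ of $\bar\pi^1$, $j^1\psi$ is its canonical lifting to $J^1J^1\pi$. The map $j^1\pi^1\colon J^1J^1\pi\to J^1\pi$ is $j^1\pi^1(\mathbf{y})=j^1(\pi^1\circ\psi)(\bar\pi^1_1(\mathbf{y}))$ for any representative $\psi$ of $\mathbf{y}$. A jet field is a section $\mathcal{Y}\colon J^1\pi\to J^1J^1\pi$ of $\pi^1_1$. A (local) section $\psi$ of $\bar\pi^1$ is an integral section of $\mathcal{Y}$ if $\mathcal{Y}\circ\psi=j^1\psi$; $\mathcal{Y}$ is integrable if through every point of $J^1\pi$ there passes a local integral section. $\mathcal{Y}$ is a SOPDE (second order partial differential equation) if $j^1\pi^1\circ\mathcal{Y}=\mathrm{Id}_{J^1\pi}$.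 A (local) section $\psi$ of $\bar\pi^1$ is holonomic if $\psi=j^1\phi$ for a (local) section $\phi$ of $\pi$. *)

(* Defs.v *)
From HB Require Import structures.
From mathcomp Require Import all_boot all_order all_algebra generic_quotient.
From mathcomp Require Import all_classical all_reals all_analysis.
Set Implicit Arguments.
Unset Strict Implicit.
Unset Printing Implicit Defensive.
Import Order.TTheory GRing.Theory Num.Theory.
Import numFieldNormedType.Exports.
Local Open Scope classical_set_scope.
Local Open Scope ring_scope.
Local Open Scope quotient_scope.

(* In [Ck_on] and [smooth_on_open], [W] is meant to be open: only the values of
   [f] on [W] matter then.  The directional derivatives of a C^(k+1) map are
   required to be C^k in every direction, which is the usual class C^(k+1). *)
Fixpoint Ck_on (R : realType) (k n p : nat) (W : set 'rV[R]_n)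
    (f : 'rV[R]_n -> 'rV[R]_p) : Prop :=
  match k with
  | 0 => forall v, W v -> {for v, continuous f}
  | l.+1 => (forall v, W v -> differentiable f v) /\
            (forall u : 'rV[R]_n, Ck_on l W (fun v => 'D_u f v))
  end.

Definition smooth_on_open (R : realType) (n p : nat) (W : set 'rV[R]_n)
    (f : 'rV[R]_n -> 'rV[R]_p) : Prop := forall k, Ck_on k W f.

(* A chart is a total function of which only the restriction to [cdom]
   is meaningful. *)
Record chart (R : realType) (n : nat) (T : Type) := Chart {
  cdom : set T;
  cmap :> T -> 'rV[R]_n }.

(* The inverse of the chart [c], defined on [c @` cdom c]; the point [x] is the
   irrelevant default value taken elsewhere. *)
Definition chart_inv (R : realType) (n : nat) (T : Type) (c : chart R n T)
  (x : T) : 'rV[R]_n -> T := 'pinv_(fun=> x) (cdom c) c.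

Definition chart_valid (R : realType) (n : nat) (T : Type) (c : chart R n T) :
  Prop := {in cdom c &, injective c} /\ open (c @` cdom c).

Definition charts_compatible (R : realType) (n : nat) (T : Type)
    (c d : chart R n T) : Prop :=
  [/\ open (c @` (cdom c `&` cdom d)),
      open (d @` (cdom c `&` cdom d)) &
      forall x, (cdom c `&` cdom d) x ->
        smooth_on_open (c @` (cdom c `&` cdom d)) (d \o chart_inv c x) /\
        smooth_on_open (d @` (cdom c `&` cdom d)) (c \o chart_inv d x)].

(* A set with a collection of charts in R^n.  The axioms of a manifold are
   stated separately, in [is_manifold], so that products and jet spaces can be
   given by their charts alone. *)
Record charted (R : realType) (n : nat) := Charted {
  carrier :> Type;
  charts : set (chart R n carrier) }.

Section ChartTopology.
Variables (R : realType) (n : nat) (X : charted R n).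

(* When the charts are valid and compatible, this says that
   [c @` (U `&` cdom c)] is open for every chart [c]. *)
Definition chart_open (U : set X) : Prop :=
  forall c, charts c -> exists V : set 'rV[R]_n,
    open V /\ U `&` cdom c = c @^-1` V `&` cdom c.

Lemma chart_openT : chart_open setT.
Proof.
by move=> c _; exists setT; split; [exact: openT | rewrite preimage_setT].
Qed.

Lemma chart_openI : setI_closed chart_open.
Proof.
move=> A B oA oB c hc; have [V [oV AV]] := oA c hc; have [W [oW BW]] := oB c hc.
exists (V `&` W); split; first exact: openI.
by rewrite preimage_setI setIIl AV BW -setIIl.
Qed.

Lemma chart_open_bigU (I : Type) (f : I -> set X) :
  (forall i, chart_open (f i)) -> chart_open (\bigcup_i f i).
Proof.
move=> of_ c hc.
have /choice [V hV] : forall i, exists V : set 'rV[R]_n,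
    open V /\ f i `&` cdom c = c @^-1` V `&` cdom c by move=> i; exact: of_.
exists (\bigcup_i V i); split; first by apply: bigcup_open => i _; case: (hV i).
rewrite preimage_bigcup !setI_bigcupl.
by apply: eq_bigcupr => i _; case: (hV i).
Qed.

HB.instance Definition _ := gen_eqMixin (carrier X).
HB.instance Definition _ := gen_choiceMixin (carrier X).
HB.instance Definition _ := isOpenTopological.Build (carrier X)
  chart_openT chart_openI chart_open_bigU.
End ChartTopology.

(* C^oo manifold of dimension [n]; [charts X] is the maximal atlas. *)
Record is_manifold (R : realType) (n : nat) (X : charted R n) : Prop := {
  manifold_valid : forall c : chart R n X, charts c -> chart_valid c;
  manifold_compatible : forall c d : chart R n X,
    charts c -> charts d -> charts_compatible c d;
  manifold_cover : forall x : X, exists2 c : chart R n X, charts c & cdom c x;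
  manifold_maximal : forall c : chart R n X, chart_valid c ->
    (forall d, charts d -> charts_compatible c d) -> charts c;
  manifold_hausdorff : hausdorff_space X;
  manifold_second_countable : @second_countable X }.

(* [f] is C^oo on the open set [U]: around every point of [U] there are charts
   in which it is represented by a C^oo map between Euclidean spaces. *)
Definition smooth_on (R : realType) (m n : nat) (X : charted R m)
    (Y : charted R n) (U : set X) (f : X -> Y) : Prop :=
  forall x, U x -> exists (c : chart R m X) (d : chart R n Y) (W : set 'rV[R]_m),
    [/\ charts c /\ cdom c x, charts d /\ cdom d (f x), open W /\ W (c x),
        W `<=` c @` (cdom c `&` U `&` f @^-1` cdom d) &
        smooth_on_open W (d \o f \o chart_inv c x)].

Definition product_chart (R : realType) (m k : nat) (X Y : Type)
    (c : chart R m X) (e : chart R k Y) : chart R (m + k) (X * Y) :=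
  Chart (cdom c `*` cdom e) (fun z => row_mx (c z.1) (e z.2)).

Definition product_charted (R : realType) (m k : nat)
    (X : charted R m) (Y : charted R k) : charted R (m + k) :=
  Charted [set a | exists (c : chart R m X) (e : chart R k Y),
    [/\ charts c, charts e & a = product_chart c e]].

Record fibred (R : realType) (m k : nat) := Fibred {
  base : charted R m;
  total : charted R (m + k);
  proj : total -> base }.

Definition local_trivialization (R : realType) (m k : nat) (p : fibred R m k)
    (F : charted R k) (U : set (base p))
    (Phi : total p -> product_charted (base p) F)
    (Psi : product_charted (base p) F -> total p) : Prop :=
  [/\ smooth_on (@proj R m k p @^-1` U) Phi,
      smooth_on [set z : product_charted (base p) F | U z.1] Psi,
      forall y, U (proj y) -> (Phi y).1 = proj y /\ Psi (Phi y) = y &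
      forall z, U z.1 -> proj (Psi z) = z.1 /\ Phi (Psi z) = z].

Record is_fiber_bundle (R : realType) (m k : nat) (p : fibred R m k) : Prop := {
  bundle_base : is_manifold (base p);
  bundle_total : is_manifold (total p);
  bundle_smooth : smooth_on setT (@proj R m k p);
  bundle_surjective : forall x : base p, exists y : total p, proj y = x;
  bundle_trivial : exists2 F : charted R k, is_manifold F &
    forall x : base p, exists U : set (base p), [/\ open U, U x &
      exists Phi Psi, @local_trivialization R m k p F U Phi Psi] }.

(* A local section over the open set [sdom]; the values of [sfun] outside
   [sdom] are irrelevant.  Global sections are those with [sdom = setT]. *)
Record local_section (R : realType) (m k : nat) (p : fibred R m k) := LocalSection {
  sdom : set (base p);
  sfun :> base p -> total p;
  sdom_open : open sdom;
  sfun_section : forall x, sdom x -> proj (sfun x) = x;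
  sfun_smooth : smooth_on sdom sfun }.

Record pointed_section (R : realType) (m k : nat) (p : fibred R m k) :=
  PointedSection {
  psec :> local_section p;
  pbase : base p;
  pbase_in : sdom psec pbase }.

HB.instance Definition _ (R : realType) (m k : nat) (p : fibred R m k) :=
  gen_eqMixin (pointed_section p).
HB.instance Definition _ (R : realType) (m k : nat) (p : fibred R m k) :=
  gen_choiceMixin (pointed_section p).

Definition local_rep (R : realType) (m k : nat) (p : fibred R m k)
    (s : pointed_section p) (c : chart R m (base p))
    (d : chart R (m + k) (total p)) : 'rV[R]_m -> 'rV[R]_(m + k) :=
  d \o s \o chart_inv c (pbase s).

(* The value and the tangent map (in coordinates) agree at a common point. *)
Definition same_jet (R : realType) (m k : nat) (p : fibred R m k)
    (s t : pointed_section p) : Prop :=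
  [/\ pbase s = pbase t, s (pbase s) = t (pbase t) &
      forall c d, charts c -> cdom c (pbase s) ->
        charts d -> cdom d (s (pbase s)) ->
        'J (local_rep s c d) (c (pbase s)) = 'J (local_rep t c d) (c (pbase s))].

Section Jets.
Variables (R : realType) (m k : nat) (p : fibred R m k).

Definition same_jetb : rel (pointed_section p) := fun s t => `[< same_jet s t >].

Lemma same_jetb_refl : reflexive same_jetb.
Proof. by move=> s; apply/asboolP. Qed.

Lemma same_jet_sym (s t : pointed_section p) : same_jet s t -> same_jet t s.
Proof.
case=> e1 e2 e3; split=> [||c d hc xc hd yd]; [exact: esym|exact: esym|].
rewrite -e2 in yd; rewrite -e1 in xc *.
by rewrite (e3 c d hc xc hd yd).
Qed.

Lemma same_jetb_sym : symmetric same_jetb.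
Proof. by move=> s t; apply/asboolP/asboolP; exact: same_jet_sym. Qed.

Lemma same_jetb_trans : transitive same_jetb.
Proof.
move=> t s u /asboolP [a1 a2 a3] /asboolP [b1 b2 b3]; apply/asboolP.
split=> [||c d hc xc hd yd]; [exact: etrans b1|exact: etrans b2|].
rewrite (a3 c d hc xc hd yd); rewrite a2 in yd; rewrite a1 in xc *.
exact: b3.
Qed.

Canonical same_jet_equiv :=
  EquivRel same_jetb same_jetb_refl same_jetb_sym same_jetb_trans.

Definition jet_space : Type := {eq_quot same_jet_equiv}.

(* The 1-jet of [phi] at [x], i.e. the value at [x] of the canonical lifting
   j^1(phi). *)
Definition jet (phi : local_section p) (x : base p) (hx : sdom phi x) : jet_space :=
  \pi_({eq_quot same_jet_equiv}) (PointedSection hx).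

Definition jet_rep (j : jet_space) : pointed_section p :=
  @repr _ ({eq_quot same_jet_equiv} : quotType _) j.

(* [jet_source] is \bar\pi^1 : J^1 pi -> M and [jet_target] is
   pi^1 : J^1 pi -> E; they do not depend on the representative. *)
Definition jet_source (j : jet_space) : base p := pbase (jet_rep j).
Definition jet_target (j : jet_space) : total p := jet_rep j (jet_source j).

(* Adapted coordinates (x^i, u^a) on the total space: [d] has the form
   (c o proj, u) on its domain. *)
Definition adapted (c : chart R m (base p)) (d : chart R (m + k) (total p)) :
    Prop :=
  forall y, cdom d y -> cdom c (proj y) /\ c (proj y) = lsubmx (d y).

(* The induced coordinates (x^i, u^a, u^a_i) of a jet, with
   u^a_i = d(u^a o phi)/dx^i. *)
Definition jet_chart (c : chart R m (base p)) (d : chart R (m + k) (total p)) :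
    chart R (m + (k + m * k)) jet_space :=
  Chart [set j | cdom d (jet_target j)]
    (fun j => row_mx (lsubmx (d (jet_target j)))
      (row_mx (rsubmx (d (jet_target j)))
        (mxvec ('J (@rsubmx _ 1 m k \o local_rep (jet_rep j) c d)
                   (c (jet_source j)))))).

Definition J1 : charted R (m + (k + m * k)) :=
  Charted [set a : chart R _ jet_space | exists c d,
    [/\ charts c, charts d, adapted c d & a = jet_chart c d]].

(* \bar\pi^1 : J^1 pi -> M, whose 1-jets form J^1 J^1 pi. *)
Definition jet_bundle : fibred R m (k + m * k) :=
  @Fibred R m (k + m * k) (base p) J1 jet_source.

Lemma jet_target_section (j : jet_space) : proj (jet_target j) = jet_source j.
Proof. exact/sfun_section/pbase_in. Qed.

End Jets.

Lemma near_eq_differentiable (R : realType) (V W : normedModType R)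
    (f g : V -> W) (x : V) :
  {near x, f =1 g} -> differentiable f x -> differentiable g x.
Proof.
move=> fg df; have /diff_locallyP [dfc fE] := df.
have gE : g \o shift x = cst (g x) + 'd f x +o_ 0 id.
  apply/eqaddoP => e e0; move/eqaddoP: fE => /(_ e e0).
  have fg0 : \forall h \near (0 : V), f (h + x) = g (h + x).
    have sx : (h + x) @[h --> (0 : V)] --> x.
      by rewrite -[X in _ --> X]add0r; apply: cvgD; [exact: cvg_id | exact: cvg_cst].
    exact: sx fg.
  apply: filterS2 fg0 => h fgh.
  by rewrite !fctE /= fgh (nbhs_singleton fg).
have dgE := diff_unique dfc gE.
by apply/diff_locallyP; rewrite dgE.
Qed.

Lemma Ck_on_linear (R : realType) (n p q : nat) (W : set 'rV[R]_n)
    (L : {linear 'rV[R]_p -> 'rV[R]_q}) (k : nat) (f : 'rV[R]_n -> 'rV[R]_p)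
    (h : 'rV[R]_n -> 'rV[R]_q) :
  open W -> continuous L -> (forall v, W v -> h v = L (f v)) ->
  Ck_on k W f -> Ck_on k W h.
Proof.
move=> oW cL; elim: k f h => [|k IH] f h hLf /=.
  move=> cf v Wv.
  have nW : \forall w \near v, W w by apply: open_nbhs_nbhs.
  suff : h @ v --> L (f v) by rewrite -hLf.
  have cLf : {for v, continuous (L \o f)}.
    by apply: continuous_comp; [exact: cf | exact: cL].
  have nE : {near v, (L \o f) =1 h}.
    apply: (@filterS _ (nbhs v) _ W) nW => w Ww /=.
    by rewrite hLf.
  exact: cvg_trans (near_eq_cvg nE) cLf.
move=> [df Df].
have nE v : W v -> {near v, (L \o f) =1 h}.
  move=> Wv; have nW : \forall w \near v, W w by apply: open_nbhs_nbhs.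
  apply: (@filterS _ (nbhs v) _ W) nW => w Ww /=.
  by rewrite hLf.
have dL v : differentiable L (f v) by apply: linear_differentiable.
split=> [v Wv|u].
  apply: near_eq_differentiable (nE v Wv) _.
  by apply: differentiable_comp => //; exact: df.
apply: (IH (fun v => 'D_u f v)) => [v Wv|]; last exact: Df.
rewrite -(near_eq_derive _ (nE v Wv)) deriveE; last first.
  by apply: differentiable_comp => //; exact: df.
rewrite diff_comp //; last exact: df.
rewrite /= (diff_lin _ cL) -deriveE //; exact: df.
Qed.

(* The coordinate expression (x^i, u^a, u^a_i) |-> (x^i, u^a) of pi^1. *)
Definition coord_target (R : realType) (m k l : nat)
    (w : 'rV[R]_(m + (k + l))) : 'rV[R]_(m + k) :=
  row_mx (lsubmx w) (lsubmx (rsubmx w)).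

Lemma coord_target_is_linear (R : realType) (m k l : nat) :
  linear (@coord_target R m k l).
Proof.
move=> a u v; by rewrite /coord_target !linearP /= scale_row_mx add_row_mx.
Qed.

HB.instance Definition _ (R : realType) (m k l : nat) :=
  GRing.isLinear.Build R 'rV[R]_(m + (k + l)) 'rV[R]_(m + k) *:%R
    (@coord_target R m k l) (@coord_target_is_linear R m k l).

Lemma coord_target_continuous (R : realType) (m k l : nat) :
  continuous (@coord_target R m k l).
Proof.
move=> u A /nbhs_ballP[e /= e0 eA].
apply/nbhs_ballP; exists e => //= v [_ uv]; apply: eA; split => // i j.
by rewrite !mxE; case: splitP => j' _; rewrite !mxE; exact: uv.
Qed.

Section SecondJets.
Variables (R : realType) (m k : nat) (p : fibred R m k).

Lemma target_smooth (psi : local_section (jet_bundle p)) :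
  smooth_on (sdom psi) (fun x => jet_target (psi x)).
Proof.
move=> x Ux; have [c [D [W [[hc xc] [hD xD] [oW Wx] WD sW]]]] := sfun_smooth Ux.
have [c' [d' [_ hd' _ DE]]] := hD.
exists c, d', W; split=> //; first by split=> //; rewrite DE in xD.
  by rewrite DE in WD.
move=> l; have := sW l; apply: Ck_on_linear (@coord_target_continuous R m k _) _ => //.
by move=> v _; rewrite DE /= /coord_target row_mxKr !row_mxKl hsubmxK.
Qed.

Lemma target_section (psi : local_section (jet_bundle p)) x :
  sdom psi x -> proj (jet_target (psi x)) = x.
Proof. by move=> Ux; rewrite jet_target_section; exact: (sfun_section Ux). Qed.

(* pi^1 o psi *)
Definition target_of_section (psi : local_section (jet_bundle p)) :
    local_section p :=
  @LocalSection R m k p (sdom psi) (fun x => jet_target (psi x))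
    (sdom_open psi) (@target_section psi) (@target_smooth psi).

(* j^1(pi^1) : J^1 J^1 pi -> J^1 pi, computed on a representative of [y]. *)
Definition j1_target (y : J1 (jet_bundle p)) : J1 p :=
  @jet R m k p (target_of_section (jet_rep y)) (pbase (jet_rep y))
    (pbase_in (jet_rep y)).

(* [jet_target] over [jet_bundle p] is the projection pi^1_1. *)
Definition is_jet_field (Y : J1 p -> J1 (jet_bundle p)) : Prop :=
  smooth_on setT Y /\ forall j : J1 p, @jet_target _ _ _ (jet_bundle p) (Y j) = j.

Definition integral_section (Y : J1 p -> J1 (jet_bundle p))
    (psi : local_section (jet_bundle p)) : Prop :=
  forall x (hx : sdom psi x), Y (psi x) = jet hx.

Definition integrable_jet_field (Y : J1 p -> J1 (jet_bundle p)) : Prop :=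
  forall j : J1 p, exists psi : local_section (jet_bundle p),
    integral_section Y psi /\ exists2 x, sdom psi x & psi x = j.

Definition SOPDE (Y : J1 p -> J1 (jet_bundle p)) : Prop :=
  forall j : J1 p, j1_target (Y j) = j.

Definition holonomic (psi : local_section (jet_bundle p)) : Prop :=
  exists phi : local_section p, sdom phi = sdom psi /\
    forall x (hx : sdom phi x), psi x = jet hx.

End SecondJets.

(* Main.v *)
Require Import Defs.
From mathcomp Require Import all_boot all_order all_algebra.
From mathcomp Require Import all_classical all_reals all_analysis.
From mathcomp Require Import generic_quotient.
Set Implicit Arguments.
Unset Strict Implicit.
Unset Printing Implicit Defensive.
Import GRing.Theory.
Import numFieldNormedType.Exports.
Local Open Scope classical_set_scope.
Local Open Scope ring_scope.

(** Write T for the operation psi |-> pi^1 o psi on sections of the jet bundle.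
By definition j^1(pi^1) sends the jet of psi at x to the jet of T psi at x.
Once this is known to hold for every representative psi (and not only for the
one chosen by [jet_rep]), that is [j1_target_jet], both implications are short.

If Y is a SOPDE and psi is an integral section, then at every point
psi(x) = j^1(pi^1)(Y(psi(x))) = j^1(pi^1)(j^1 psi(x)) = j^1(T psi)(x), so psi is
the canonical lifting of T psi.  Conversely, a point of J^1 pi is psi(x) for an
integral section psi, by integrability; if psi = j^1 phi then T psi = phi near
x, so j^1(pi^1)(Y(psi(x))) = j^1(T psi)(x) = j^1 phi(x) = psi(x).

The independence of the representative is [same_jet_target].  Let s and t have
the same jet at x as sections of the jet bundle.  Smoothness of s provides an
adapted chart (x^i, u^a) of E, with induced chart (x^i, u^a, u^a_i), in which s
is differentiable.  In these charts T s is obtained from s by forgetting the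
u^a_i, a linear operation, so the Jacobian of T s is determined by that of s.
There remain two points.
- Equality of 1-jets is to be tested in all pairs of charts of M and E, not only
  in adapted ones; by the chain rule one pair is enough ([same_jet_chart]).
- The chain rule for T t asks for differentiability of t in a chart chosen for
  s.  It follows from equality of the Jacobians: the first m components of s
  form the identity, so its Jacobian is nonzero if m > 0, whereas the Jacobian
  of a map that is not differentiable is zero by convention
  ([eq_jacobian_comp]). *)

(** * Jacobian matrices *)

Section Jacobian.
Variable R : realType.

Lemma jacobian_near_eq m n (f g : 'rV[R]_m -> 'rV[R]_n) (v : 'rV[R]_m) :
  differentiable f v -> {near v, f =1 g} -> 'J f v = 'J g v.
Proof.
move=> df fg; have dg := near_eq_differentiable fg df.
have dfg u : 'd f v u = 'd g v u.
  apply: etrans (esym (deriveE u df)) _; apply: etrans (deriveE u dg).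
  exact: near_eq_derive.
apply/matrixP => i j; rewrite [LHS]mxE [RHS]mxE.
by have /rowP /(_ j) := dfg (delta_mx 0 i).
Qed.

Lemma near_differentiable m n (f : 'rV[R]_m -> 'rV[R]_n) (v : 'rV[R]_m)
    (P : set 'rV[R]_n) :
  differentiable f v -> (\forall w \near f v, P w) ->
  \forall u \near v, P (f u).
Proof. by move=> /differentiable_continuous cf nP; exact: (cf P nP). Qed.

Lemma differentiable_comp_at m n q (f : 'rV[R]_m -> 'rV[R]_n)
    (g : 'rV[R]_n -> 'rV[R]_q) (v : 'rV[R]_m) (w : 'rV[R]_n) :
  f v = w -> differentiable f v -> differentiable g w ->
  differentiable (g \o f) v.
Proof. by move=> <-; exact: differentiable_comp. Qed.

Lemma jacobian_comp m n q (f : 'rV[R]_m -> 'rV[R]_n) (g : 'rV[R]_n -> 'rV[R]_q)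
    (v : 'rV[R]_m) (w : 'rV[R]_n) :
  f v = w -> differentiable f v -> differentiable g w ->
  'J (g \o f) v = 'J f v *m 'J g w.
Proof.
move=> <- df dg; apply/matrixP => i j; rewrite [LHS]mxE.
apply: etrans
  (congr1 (fun h : 'rV_m -> 'rV_q => h 'e_i 0 j) (diff_comp df dg)) _.
rewrite [RHS]mxE /= -[LHS](congr1 (fun w : 'rV_q => w 0 j) (mul_rV_lin1 _ _)).
rewrite [LHS]mxE.
by apply: eq_bigr => l _; congr (_ * _); rewrite [RHS]mxE.
Qed.

(** The differential is chosen among the linear maps that satisfy its defining
property; when there are none, the choice falls on the zero map. *)
Lemma diff_not_differentiable (V W : normedModType R) (f : V -> W) (x : V) :
  ~ differentiable f x -> 'd f x = \0 :> {linear V -> W}.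
Proof.
move=> ndf; apply: getPN => df dfP; apply/ndf/(diffP (nbhs_filter_on x)).
rewrite /diff; set P := (X in get X); exact: (@getI _ P df dfP).
Qed.

Lemma jacobian_not_differentiable m n (f : 'rV[R]_m -> 'rV[R]_n)
    (v : 'rV[R]_m) :
  ~ differentiable f v -> 'J f v = 0.
Proof.
move=> ndf; apply/matrixP => i j; rewrite [LHS]mxE.
by rewrite diff_not_differentiable// [LHS]mxE [RHS]mxE.
Qed.

(** A graph over its first [m] coordinates has a Jacobian of full rank: this is
the chain rule applied to [lsubmx \o f], whose Jacobian is the identity. *)
Lemma jacobian_lsubmx_id m n (f : 'rV[R]_m -> 'rV[R]_(m + n)) (v : 'rV[R]_m) :
  differentiable f v -> {near v, lsubmx \o f =1 id} ->
  'J f v *m 'J lsubmx (f v) = 1%:M.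
Proof.
move=> df fid; have dl : differentiable (@lsubmx R 1 m n) (f v).
  exact: differentiable_lsubmx.
rewrite -(jacobian_comp erefl df dl).
have -> : 'J (lsubmx \o f) v = 'J id v.
  by apply: jacobian_near_eq => //; exact: differentiable_comp.
apply/matrixP => i j; rewrite [LHS]mxE diff_val.
by rewrite !mxE eqxx /= eq_sym.
Qed.

(** The chain rule for [g] needs [g] to be differentiable.  Were it not, its
Jacobian, hence also that of [f], would be zero; as the latter has a right
inverse, this forces the identity matrix of size [m] to be zero, so [m] is zero
and all the matrices with [m] rows are equal. *)
Lemma eq_jacobian_comp m n q (f g : 'rV[R]_m -> 'rV[R]_(m + n))
    (h : 'rV[R]_(m + n) -> 'rV[R]_q) (v : 'rV[R]_m) :
  differentiable f v -> {near v, lsubmx \o f =1 id} ->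
  f v = g v -> differentiable h (f v) ->
  'J f v = 'J g v -> 'J (h \o f) v = 'J (h \o g) v.
Proof.
move=> df fid fg dh Jfg.
have [dg|ndg] := pselect (differentiable g v).
  apply: etrans (jacobian_comp erefl df dh) _; rewrite Jfg.
  exact/esym/(jacobian_comp (esym fg) dg dh).
have one0 : 1%:M = 0 :> 'M[R]_m.
  rewrite -(jacobian_lsubmx_id df fid) Jfg (jacobian_not_differentiable ndg).
  exact: mul0mx.
have all0 (A : 'M[R]_(m, q)) : A = 0 by rewrite -[A]mul1mx one0 mul0mx.
exact: etrans (all0 _) (esym (all0 _)).
Qed.

End Jacobian.

(** * Charts of a manifold *)

Section Charts.
Variables (R : realType) (n : nat) (X : charted R n).

Lemma chart_invK (c : chart R n X) (x z : X) :
  chart_valid c -> cdom c x -> chart_inv c z (c x) = x.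
Proof.
by move=> [cinj _] cx; apply: (@pinvKV _ _ (fun=> z) _ c cinj); rewrite inE.
Qed.

Hypothesis hX : is_manifold X.

Lemma near_chart_image (A : set X) (c : chart R n X) (x z : X) :
  charts c -> cdom c x -> open (c @` (cdom c `&` A)) -> A x ->
  \forall v \near c x,
    [/\ cdom c (chart_inv c z v), A (chart_inv c z v) &
       c (chart_inv c z v) = v].
Proof.
move=> hc cx oA Ax; have vc := manifold_valid hX hc.
have : nbhs (c x) (c @` (cdom c `&` A)).
  by apply: open_nbhs_nbhs; split => //; exists x.
by apply: filterS => _ [y [cy Ay] <-]; rewrite chart_invK.
Qed.

Lemma near_chart (A : set X) (c : chart R n X) (x z : X) :
  charts c -> cdom c x -> open A -> A x ->
  \forall v \near c x,
    [/\ cdom c (chart_inv c z v), A (chart_inv c z v) &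
       c (chart_inv c z v) = v].
Proof.
move=> hc cx oA Ax; apply: near_chart_image => //.
have [_ oc] := manifold_valid hX hc; have [V [oV AV]] := oA c hc.
have -> : c @` (cdom c `&` A) = V `&` c @` cdom c; last exact: openI.
rewrite setIC AV; apply/seteqP; split => [_ [y [Vy cy] <-]|v [Vv [y cy yv]]].
  by split => //; exists y.
by exists y => //; split => //=; rewrite yv.
Qed.

Lemma near_chart_chart (c d : chart R n X) (x z : X) :
  charts c -> charts d -> cdom c x -> cdom d x ->
  \forall v \near c x,
    [/\ cdom c (chart_inv c z v), cdom d (chart_inv c z v) &
       c (chart_inv c z v) = v].
Proof.
move=> hc hd cx dx; have [oc _ _] := manifold_compatible hX hc hd.
exact: near_chart_image.
Qed.

Lemma transition_differentiable (c d : chart R n X) (x : X) :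
  charts c -> charts d -> cdom c x -> cdom d x ->
  differentiable (d \o chart_inv c x) (c x).
Proof.
move=> hc hd cx dx; have [_ _ /(_ x (conj cx dx))[sd _]] :=
  manifold_compatible hX hc hd.
by have [+ _] := sd 1; apply; exists x.
Qed.

Lemma transitionE (c d : chart R n X) (x : X) :
  cdom c x -> charts c -> (d \o chart_inv c x) (c x) = d x.
Proof. by move=> cx hc /=; rewrite chart_invK//; exact: manifold_valid. Qed.

End Charts.

(** * Smooth maps in arbitrary charts *)

Section SmoothMaps.
Variables (R : realType) (m n : nat) (X : charted R m) (Y : charted R n).
Hypothesis hX : is_manifold X.

(** The first condition is what makes the second one meaningful: a chart is a
total function whose values outside its domain are arbitrary. *)
Definition differentiable_in (f : X -> Y) (x : X) (c : chart R m X)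
    (d : chart R n Y) : Prop :=
  (\forall v \near c x, cdom d (f (chart_inv c x v))) /\
  differentiable (d \o f \o chart_inv c x) (c x).

(** Smoothness gives one chart on each side.  Replacing that of the source uses
the transition maps of the source alone, so [Y] may be any set with charts, in
particular a jet space. *)
Lemma smooth_differentiable_in (U : set X) (f : X -> Y) (x : X) :
  smooth_on U f -> U x -> exists d, [/\ charts d, cdom d (f x) &
    forall c, charts c -> cdom c x -> differentiable_in f x c d].
Proof.
move=> sf Ux; have [c0 [d [W [[hc0 c0x] [hd dfx] [oW Wx] WE sW]]]] := sf x Ux.
exists d; split => // c hc cx.
have vc0 := manifold_valid hX hc0.
have dt := transition_differentiable hX hc hc0 cx c0x.
have tE := transitionE hX c0 cx hc.
have nW : \forall v \near c x, W (c0 (chart_inv c x v)).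
  apply: (near_differentiable (P := W) dt).
  by rewrite tE; exact: open_nbhs_nbhs.
have nc := near_chart_chart hX x hc hc0 cx c0x.
split.
  apply: filterS2 nW nc => v Wv [_ c0v _].
  have [y [[c0y _] dfy] yE] := WE _ Wv.
  have [c0inj _] := vc0.
  by rewrite -(c0inj _ _ _ _ yE) // inE.
apply: (@near_eq_differentiable _ _ _
  ((d \o f \o chart_inv c0 x) \o (c0 \o chart_inv c x))).
  by apply: filterS nc => v [_ c0v _] /=; rewrite chart_invK.
apply: (differentiable_comp_at tE dt).
by have [+ _] := sW 1; apply.
Qed.

Hypothesis hY : is_manifold Y.

Lemma differentiable_in_chart_change (f : X -> Y) (x : X) (c : chart R m X)
    (d d' : chart R n Y) :
  charts c -> cdom c x -> charts d -> cdom d (f x) ->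
  charts d' -> cdom d' (f x) ->
  differentiable_in f x c d -> differentiable_in f x c d'.
Proof.
move=> hc cx hd dy hd' d'y [nd df].
have vd := manifold_valid hY hd.
have fE : (d \o f \o chart_inv c x) (c x) = d (f x).
  by rewrite /= chart_invK//; exact: (manifold_valid hX).
split.
  (* Membership in cdom d' is an open condition in the coordinates of d, to be
     pulled back by the continuous expression of f in c and d. *)
  have : \forall v \near c x,
      cdom d' (chart_inv d (f x) (d (f (chart_inv c x v)))).
    apply: (near_differentiable
      (P := fun w => cdom d' (chart_inv d (f x) w)) df).
    rewrite fE.
    by apply: filterS (near_chart_chart hY (f x) hd hd' dy d'y) => w [].
  by apply: filterS2 nd => v dv; rewrite chart_invK.
apply: (@near_eq_differentiable _ _ _
  ((d' \o chart_inv d (f x)) \o (d \o f \o chart_inv c x))).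
  by apply: filterS nd => v dv /=; rewrite chart_invK.
by apply: (differentiable_comp_at fE df); exact: transition_differentiable.
Qed.

Lemma smooth_differentiable_in_charts (U : set X) (f : X -> Y) (x : X)
    (c : chart R m X) (d : chart R n Y) :
  smooth_on U f -> U x -> charts c -> cdom c x -> charts d -> cdom d (f x) ->
  differentiable_in f x c d.
Proof.
move=> sf Ux hc cx hd dy.
have [d0 [hd0 d0y df]] := smooth_differentiable_in sf Ux.
exact: (differentiable_in_chart_change hc cx hd0 d0y hd dy (df c hc cx)).
Qed.

End SmoothMaps.

(** * Equality of 1-jets *)

Lemma eq_local_rep (R : realType) (m k : nat) (p : fibred R m k)
    (s t : pointed_section p) (c : chart R m (base p))
    (d : chart R (m + k) (Defs.total p)) :
  pbase s = pbase t -> s (pbase s) = t (pbase t) ->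
  chart_valid c -> cdom c (pbase s) ->
  local_rep s c d (c (pbase s)) = local_rep t c d (c (pbase s)).
Proof.
move=> xE yE vc cx; rewrite /local_rep /= -xE (chart_invK _ vc cx).
by rewrite yE xE.
Qed.

Section JetsOfSections.
Variables (R : realType) (m k : nat) (p : fibred R m k).
Hypotheses (hM : is_manifold (base p)) (hE : is_manifold (Defs.total p)).

Lemma local_rep_differentiable (s : pointed_section p)
    (c : chart R m (base p)) (d : chart R (m + k) (Defs.total p)) :
  charts c -> cdom c (pbase s) -> charts d -> cdom d (s (pbase s)) ->
  differentiable_in s (pbase s) c d.
Proof.
move=> hc cx hd dy; apply: (smooth_differentiable_in_charts hM hE) => //.
  exact: (@sfun_smooth _ _ _ _ s).
exact: pbase_in.
Qed.

(** Near the point, the expression of [s] in the new charts is its expression in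
the old ones between two transition maps. *)
Lemma jacobian_local_rep_change (s : pointed_section p)
    (c c' : chart R m (base p)) (d d' : chart R (m + k) (Defs.total p)) :
  charts c -> cdom c (pbase s) -> charts d -> cdom d (s (pbase s)) ->
  charts c' -> cdom c' (pbase s) -> charts d' -> cdom d' (s (pbase s)) ->
  'J (local_rep s c' d') (c' (pbase s)) =
  'J (c \o chart_inv c' (pbase s)) (c' (pbase s)) *m
  ('J (local_rep s c d) (c (pbase s)) *m
   'J (d' \o chart_inv d (s (pbase s))) (d (s (pbase s)))).
Proof.
set x := pbase s; set y := s x => hc cx hd dy hc' c'x hd' d'y.
have vc := manifold_valid hM hc; have vd := manifold_valid hE hd.
have [_ ds] := local_rep_differentiable hc cx hd dy.
have [nd _] := local_rep_differentiable hc' c'x hd dy.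
have dc := transition_differentiable hM hc' hc c'x cx.
have dd := transition_differentiable hE hd hd' dy d'y.
have cE := transitionE hM c c'x hc'.
have sE : local_rep s c d (c x) = d y by rewrite /local_rep /= chart_invK.
have dsd := differentiable_comp_at sE ds dd.
apply: etrans (congr1 (mulmx _) (jacobian_comp sE ds dd)).
apply: etrans (jacobian_comp cE dc dsd).
apply/esym/jacobian_near_eq; first exact: differentiable_comp_at cE dc dsd.
apply: filterS2 nd (near_chart_chart hM x hc' hc c'x cx) => v dv [_ cv _].
by rewrite /local_rep /= chart_invK// chart_invK.
Qed.

(** The transition matrices between two pairs of charts depend only on the
source and the target of the jet, so they are the same for [s] and [t]. *)
Lemma same_jet_chart (s t : pointed_section p)
    (c : chart R m (base p)) (d : chart R (m + k) (Defs.total p)) :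
  pbase s = pbase t -> s (pbase s) = t (pbase t) ->
  charts c -> cdom c (pbase s) -> charts d -> cdom d (s (pbase s)) ->
  'J (local_rep s c d) (c (pbase s)) = 'J (local_rep t c d) (c (pbase s)) ->
  same_jet s t.
Proof.
move=> xE yE hc cx hd dy JE.
split=> [||c' d' hc' c'x hd' d'y]; [exact: xE|exact: yE|].
apply: etrans (jacobian_local_rep_change hc cx hd dy hc' c'x hd' d'y) _.
rewrite JE yE xE in cx c'x dy d'y *; apply/esym.
exact: jacobian_local_rep_change.
Qed.

Lemma same_jet_germ (s t : pointed_section p) :
  pbase s = pbase t -> (forall x, sdom s x -> s x = t x) -> same_jet s t.
Proof.
move=> xE st; have yE : s (pbase s) = t (pbase t).
  by rewrite -xE st//; exact: pbase_in.
split=> [||c d hc cx hd dy]; [exact: xE|exact: yE|].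
have [_ ds] := local_rep_differentiable hc cx hd dy.
apply: (jacobian_near_eq ds).
apply: filterS (near_chart hM (pbase s) hc cx (sdom_open s) (pbase_in s)).
by move=> v [_ /st sv _]; rewrite /local_rep /= sv xE.
Qed.

End JetsOfSections.

Section JetClasses.
Variables (R : realType) (m k : nat) (p : fibred R m k).

Lemma eq_jet (phi psi : local_section p) (x y : base p)
    (hx : sdom phi x) (hy : sdom psi y) :
  same_jet (PointedSection hx) (PointedSection hy) -> jet hx = jet hy.
Proof. move=> st.
apply: (elimT (@eqmodP _ (same_jet_equiv p) (PointedSection hx)
  (PointedSection hy))).
exact/asboolP. Qed.

Lemma jet_rep_same_jet (phi : local_section p) (x : base p) (hx : sdom phi x) :
  same_jet (jet_rep (jet hx)) (PointedSection hx).
Proof. apply/asboolP.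
apply: (introT (@eqmodP _ (same_jet_equiv p) (jet_rep (jet hx))
  (PointedSection hx))).
exact: reprK. Qed.

Lemma jet_targetE (phi : local_section p) (x : base p) (hx : sdom phi x) :
  jet_target (jet hx) = phi x.
Proof. by have [] := jet_rep_same_jet hx. Qed.

End JetClasses.

(** * The map j^1(pi^1) on representatives *)

Section Target.
Variables (R : realType) (m k : nat) (p : fibred R m k).
Hypotheses (hM : is_manifold (base p)) (hE : is_manifold (Defs.total p)).

Definition target_of_pointed (s : pointed_section (jet_bundle p)) :
    pointed_section p :=
  @PointedSection R m k p (target_of_section s) (pbase s) (pbase_in s).

(** The chart [c'] enters the induced chart only through the coordinates u^a_i,
which [coord_target] forgets. *)
Lemma local_rep_target (s : pointed_section (jet_bundle p))
    (c c' : chart R m (base p)) (d : chart R (m + k) (Defs.total p)) :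
  local_rep (target_of_pointed s) c d =
  @coord_target R m k (m * k) \o local_rep s c (jet_chart c' d).
Proof.
apply: funext => v.
by rewrite /local_rep /= /coord_target row_mxKr !row_mxKl hsubmxK.
Qed.

(** For an adapted chart, the first [m] coordinates of a point of the fibre over
[x] are those of [x]; a section therefore has the identity as base part. *)
Lemma local_rep_base (s : pointed_section (jet_bundle p))
    (c : chart R m (base p)) (d : chart R (m + k) (Defs.total p)) :
  charts c -> cdom c (pbase s) -> adapted c d ->
  (\forall v \near c (pbase s),
     cdom (jet_chart c d) (s (chart_inv c (pbase s) v))) ->
  {near c (pbase s), lsubmx \o local_rep s c (jet_chart c d) =1 id}.
Proof.
move=> hc cx cd nd.
apply: filterS2 nd (near_chart hM (pbase s) hc cx (sdom_open s) (pbase_in s)).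
move=> v dv [_ sv vE]; rewrite /local_rep /= row_mxKl.
have [_ <-] := cd _ dv.
by rewrite target_section.
Qed.

(** This says that j^1(pi^1) is well defined on jets.  The adapted chart around
the target comes from the smoothness of [s], since the charts of the jet space
are all induced by adapted ones. *)
Lemma same_jet_target (s t : pointed_section (jet_bundle p)) :
  same_jet s t -> same_jet (target_of_pointed s) (target_of_pointed t).
Proof.
move=> [xE yE JE].
have [D [hD Dy dD]] := @smooth_differentiable_in R m _ (base p) (J1 p) hM _ _ _
  (@sfun_smooth _ _ _ _ s) (pbase_in s).
have [c [d [hc hd cd DE]]] := hD; rewrite DE in hD Dy dD.
have cx : cdom c (pbase s).
  by have [+ _] := cd _ Dy; rewrite target_section//; exact: pbase_in.
have [nD ds] := dD c hc cx.
have tyE : jet_target (s (pbase s)) = jet_target (t (pbase t)) by rewrite yE.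
apply: (same_jet_chart hM hE (s := target_of_pointed s)
  (t := target_of_pointed t) xE tyE hc cx hd Dy).
have fid := local_rep_base hc cx cd nD.
have fg : local_rep s c (jet_chart c d) (c (pbase s)) =
    local_rep t c (jet_chart c d) (c (pbase s)).
  have vc := manifold_valid hM hc.
  exact: (@eq_local_rep _ _ _ (jet_bundle p) s t c _ xE yE vc cx).
have dh : differentiable (@coord_target R m k (m * k))
    (local_rep s c (jet_chart c d) (c (pbase s))).
  exact/linear_differentiable/coord_target_continuous.
have JD := eq_jacobian_comp ds fid fg dh (JE c _ hc cx hD Dy).
rewrite (local_rep_target s c c d) (local_rep_target t c c d).
exact: JD.
Qed.

Lemma j1_target_jet (psi : local_section (jet_bundle p)) (x : base p)
    (hx : sdom psi x) :
  j1_target (jet hx) = @jet R m k p (target_of_section psi) x hx.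
Proof. exact/eq_jet/(same_jet_target (jet_rep_same_jet hx)). Qed.

End Target.

Theorem proposition4 (R : realType) (m k : nat) (p : fibred R m k)
    (hp : is_fiber_bundle p) (Y : J1 p -> J1 (jet_bundle p))
    (hY : is_jet_field Y) (hI : integrable_jet_field Y) :
  SOPDE Y <->
  (forall psi : local_section (jet_bundle p),
     integral_section Y psi -> holonomic psi).
Proof.
have hM := bundle_base hp; have hE := bundle_total hp.
split=> [sY psi Ypsi|hol j].
  exists (target_of_section psi); split => // x hx.
  by rewrite -[LHS]sY (Ypsi _ hx); exact: j1_target_jet.
have [psi [Ypsi [x hx <-]]] := hI j.
have [phi [phiE psiE]] := hol _ Ypsi.
have hx' : sdom phi x by rewrite phiE.
rewrite (Ypsi _ hx) j1_target_jet// (psiE _ hx').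
apply/eq_jet/same_jet_germ => //= y; rewrite -phiE => hy.
by rewrite (psiE _ hy) jet_targetE.
Qed.
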